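(* Let $(c_n),(d_n)$ be sequences of non-negative reals with $c_n=o(\log n)$, $d_n=o(\log n)$, and suppose the edge probabilities are $p_n=c_nn^{-1}\in[0,1]$ and $q_n=d_nn^{-1}\in[0,1]$ (Kesten-Stigum phase). For every $n\ge1$ let $\theta_n\in\Theta_n$, $X^n\sim P_{\theta_n}$, and choose the uniform prior on $\Theta_n$. Let $(a_n)$ be a sequence with $0<a_n<1/2$. If $$a_nn\Bigl(\log(a_n)+\frac14\bigl(\sqrt{c_n}-\sqrt{d_n}\bigr)^2-1\Bigr)\to\infty\qquad(n\to\infty),$$ then for any sequence of integers $(k_n)$ with $k_n\ge a_nn$ the posterior recovers the community assignment almost-exactly with error rate $k_n$, i.e. $$P_{\theta_n}\Pi\bigl(B_n(\theta_n,k_n)\bigm|X^n\bigr)\to1\qquad(n\to\infty).$$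
   Context: Stochastic block model with two communities: for $n\ge1$ and $0\le m\le\lfloor n/2\rfloor$ let $\Theta_{n,m}=\{\theta_n\in\{0,1\}^n:\sum_i\theta_{n,i}=m\}$, except that for even $n$ and $m=n/2$, $\Theta_{n,n/2}=\{\theta_n\in\{0,1\}^n:\sum_i\theta_{n,i}=n/2,\ \theta_{n,1}=0\}$. Let $\Theta_n=\bigcup_{m=0}^{\lfloor n/2\rfloor}\Theta_{n,m}$; it has $2^{n-1}$ elements. Let $p_n,q_n\in[0,1]$. Under $P_{\theta_n}$ the observed random graph $X^n=\{X_{ij}:1\le i<j\le n\}\in\mathscr{X}_n=\{0,1\}^{\{(i,j):1\le i<j\le n\}}$ has independent edges with $P_{\theta_n}(X_{ij}=1)=Q_{ij}(\theta_n)$, where $Q_{ij}(\theta_n)=p_n$ if $\theta_{n,i}=\theta_{n,j}$ and $Q_{ij}(\theta_n)=q_n$ if $\theta_{n,i}\ne\theta_{n,j}$. Its probability mass function is $p_{\theta_n}(x^n)=\prod_{i<j}Q_{ij}(\theta_n)^{x_{ij}}(1-Q_{ij}(\theta_n))^{1-x_{ij}}$ (with $0^0=1$). The uniform prior gives mass $2^{-(n-1)}$ to each element of $\Theta_n$; the corresponding posterior is $\Pi(A\mid X^n)=\sum_{\theta\in A}p_{\theta}(X^n)\big/\sum_{\theta'\in\Theta_n}p_{\theta'}(X^n)$ for $A\subset\Theta_n$ (defined whenever the denominator is positive, which holds $P_{\theta_n}$-almost surely for each $\theta_n\in\Theta_n$). $P_{\theta_n}f(X^n)$ denotes the expectation of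 $f(X^n)$ under $P_{\theta_n}$. For $\theta_n,\eta_n\in\Theta_n$: $h(\theta_n,\eta_n)=\sum_i|\theta_{n,i}-\eta_{n,i}|$, $k(\theta_n,\eta_n)=\min\{h(\theta_n,\eta_n),\,n-h(\theta_n,\eta_n)\}$, and $B_n(\theta_n,r)=\{\eta_n\in\Theta_n:k(\eta_n,\theta_n)\le r\}$ for real $r\ge0$. *)

(* Defs.v *)
From HB Require Import structures.
From mathcomp Require Import all_boot all_order all_algebra.
From mathcomp Require Import all_classical all_reals all_analysis.
Set Implicit Arguments.
Unset Strict Implicit.
Unset Printing Implicit Defensive.
Import Order.TTheory GRing.Theory Num.Theory.
Import numFieldNormedType.Exports.

Local Open Scope ring_scope.

(* Vertices are numbered from 0, so the first vertex is the one of value 0. *)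
Definition labelling (n : nat) : finType := {ffun 'I_n -> bool}.

Definition Theta_nm (n m : nat) : {set labelling n} :=
  [set t : labelling n |
    (\sum_(i < n) t i == m)%N
    && ((n == m.*2) ==> [forall i : 'I_n, (val i == 0%N) ==> ~~ t i])].

Definition Theta (n : nat) : {set labelling n} :=
  \bigcup_(m < n./2.+1) Theta_nm n m.

Definition edge (n : nat) : finType :=
  {e : 'I_n * 'I_n | (val e.1 < val e.2)%N}.

Definition graph (n : nat) : finType := {ffun edge n -> bool}.

Definition edge_prob (R : realType) (n : nat) (p q : R) (t : labelling n)
    (e : edge n) : R :=
  if t (val e).1 == t (val e).2 then p else q.

Definition sbm_pmf (R : realType) (n : nat) (p q : R) (t : labelling n)
    (x : graph n) : R :=
  \prod_(e : edge n)
    (edge_prob p q t e ^+ x e * (1 - edge_prob p q t e) ^+ (1 - x e)%N).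

Definition sbm_expectation (R : realType) (n : nat) (p q : R)
    (t : labelling n) (f : graph n -> R) : R :=
  \sum_(x : graph n) sbm_pmf p q t x * f x.

Definition uniform_prior (R : realType) (n : nat) (t : labelling n) : R :=
  if t \in Theta n then (2 ^+ n.-1)^-1 else 0.

(* When the denominator vanishes this is 0 (division by zero in a field);
   such x have probability 0 under every t in Theta n that the prior charges,
   so expectations are unaffected. *)
Definition posterior (R : realType) (n : nat) (p q : R)
    (prior : labelling n -> R) (A : {set labelling n}) (x : graph n) : R :=
  (\sum_(t in A) prior t * sbm_pmf p q t x)
  / (\sum_(t in Theta n) prior t * sbm_pmf p q t x).

(* The labels are coerced from bool to int, as 0 or 1, and the absolute value
   is taken in nat. *)
Definition hamming (n : nat) (t u : labelling n) : nat :=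
  (\sum_(i < n) `|t i - u i|)%N.

Definition kdist (n : nat) (t u : labelling n) : nat :=
  minn (hamming t u) (n - hamming t u).

Definition ball_n (R : realType) (n : nat) (t : labelling n) (r : R) :
    {set labelling n} :=
  [set u in Theta n | (kdist u t)%:R <= r].

(* Main.v *)
Require Import Defs.
From HB Require Import structures.
From mathcomp Require Import all_boot all_order all_algebra.
From mathcomp Require Import all_classical all_reals all_analysis.
From mathcomp Require Import lra zify.
Import Order.TTheory GRing.Theory Num.Theory.
Import numFieldNormedType.Exports.
Local Open Scope classical_set_scope.
Local Open Scope ring_scope.

(** The expected posterior mass of a set A of labellings is close to 1 as soon
    as every labelling u outside A is hard to confuse with the truth t.  By
    Bayes' formula the mass of u, averaged over the graph x, is at most the sum
    over x of p_t p_u / (p_t + ... + p_u + ...), hence at most the Hellinger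
    affinity, the sum over x of the square root of p_t(x) p_u(x)
    ([posterior_mass_ge]).

    The affinity of product measures is the product of the affinities of their
    factors ([sbm_affinity]).  An edge contributes 1 unless t and u classify it
    differently (as inside or across communities), and then it contributes
    rho = sqrt (p q) + sqrt ((1 - p) (1 - q)), which is at most
    exp (- (sqrt p - sqrt q)^2 / 2).  If u differs from t at h vertices, the
    edges classified differently are those between these h vertices and the
    other n - h.  Their number h (n - h) is at least k n / 2, where
    k = min (h, n - h), because max (h, n - h) is at least n / 2.  With p = c / n
    and q = d / n the affinity is thus at most exp (- k S / 4), where
    S = (sqrt c - sqrt d)^2 ([affinity_le_kdist]).

    It remains to sum exp (- k S / 4) over all u with k > k_n >= a n, which is
    done by exponential tilting rather than by estimating binomial coefficients
    ([affinity_sum_far_le]).  Put l = log a + S / 4, so that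
    exp (- k S / 4) = a^k exp (- l k).  When l >= 0, the second factor is at most
    exp (- l a n) on the range of summation, and the sum of a^k over all
    labellings is at most 2 (1 + a)^n <= 2 exp (a n), since k is one of h and
    n - h and the sum of a^h over all labellings is exactly (1 + a)^n.  The total
    is at most 2 exp (- a n (l - 1)), and a n (l - 1) is the quantity assumed to
    tend to infinity; its eventual positivity also provides l >= 0. *)

(** * Affinity of two Bernoulli laws *)

Definition bernoulli_affinity {R : realType} (p q : R) : R :=
  Num.sqrt (p * q) + Num.sqrt ((1 - p) * (1 - q)).

Lemma bernoulli_affinity_refl (R : realType) (p : R) :
  0 <= p <= 1 -> bernoulli_affinity p p = 1.
Proof.
case/andP=> p0 p1; rewrite /bernoulli_affinity -!expr2 !sqrtr_sqr.
by rewrite !ger0_norm ?subr_ge0 // addrC subrK.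
Qed.

Lemma bernoulli_affinityC (R : realType) (p q : R) :
  bernoulli_affinity p q = bernoulli_affinity q p.
Proof. by rewrite /bernoulli_affinity mulrC [(1 - p) * _]mulrC. Qed.

Lemma sqrtr_mul_le_mean (R : realType) (x y : R) :
  0 <= x -> 0 <= y -> Num.sqrt (x * y) <= (x + y) / 2.
Proof.
move=> x0 y0; rewrite -[leRHS]ger0_norm; last by rewrite divr_ge0 ?addr_ge0.
by rewrite -sqrtr_sqr ler_wsqrtr // leif_AGM2.
Qed.

(** By the inequality of arithmetic and geometric means for 1 - p and 1 - q, the
    affinity is at most 1 - (sqrt p - sqrt q)^2 / 2. *)
Lemma bernoulli_affinity_le_expR (R : realType) (p q : R) :
  0 <= p <= 1 -> 0 <= q <= 1 ->
  bernoulli_affinity p q <= expR (- ((Num.sqrt p - Num.sqrt q) ^+ 2 / 2)).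
Proof.
case/andP=> p0 p1 /andP[q0 q1]; apply: le_trans (expR_ge1Dx _).
rewrite /bernoulli_affinity sqrtrM // sqrrB !sqr_sqrtr //.
have := @sqrtr_mul_le_mean _ (1 - p) (1 - q); rewrite !subr_ge0 => /(_ p1 q1).
set s := Num.sqrt (_ * _); lra.
Qed.

(** * Affinity of two block models *)

Lemma edge_prob01 (R : realType) (n : nat) (p q : R) (t : labelling n) e :
  0 <= p <= 1 -> 0 <= q <= 1 -> 0 <= edge_prob p q t e <= 1.
Proof. by rewrite /edge_prob; case: ifP. Qed.

Lemma bernoulli_pmf_ge0 (R : realType) (p : R) (b : bool) :
  0 <= p <= 1 -> 0 <= p ^+ b * (1 - p) ^+ (1 - b)%N.
Proof. by case/andP=> p0 p1; rewrite mulr_ge0 ?exprn_ge0 ?subr_ge0. Qed.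

Lemma sbm_pmf_ge0 (R : realType) (n : nat) (p q : R) (t : labelling n) x :
  0 <= p <= 1 -> 0 <= q <= 1 -> 0 <= sbm_pmf p q t x.
Proof.
by move=> hp hq; apply: prodr_ge0 => e _; apply/bernoulli_pmf_ge0/edge_prob01.
Qed.

Lemma sqrtr_prod (R : realType) (I : finType) (F : I -> R) :
  (forall i, 0 <= F i) -> Num.sqrt (\prod_i F i) = \prod_i Num.sqrt (F i).
Proof.
move=> F0; suff [_ ->] : 0 <= \prod_i F i /\
  Num.sqrt (\prod_i F i) = \prod_i Num.sqrt (F i) by [].
elim/big_rec2: _ => [|i y x _ [x0 <-]]; first by rewrite ler01 sqrtr1.
by rewrite mulr_ge0 // sqrtrM.
Qed.

(** The labels u_i and t_i differ at one end of the edge and not at the other: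
    this is the case exactly when one of t, u has the edge inside a community
    and the other has it across. *)
Definition disagreement_edges {n : nat} (t u : labelling n) : {set edge n} :=
  [set e | (u (val e).1 != t (val e).1) != (u (val e).2 != t (val e).2)].

Lemma sum_graph_prod (R : realType) (n : nat) (F : edge n -> bool -> R) :
  \sum_(x : graph n) \prod_e F e (x e) = \prod_e (F e true + F e false).
Proof.
by rewrite -bigA_distr_bigA; apply: eq_bigr => e _; rewrite big_bool.
Qed.

Lemma sum_sbm_pmf (R : realType) (n : nat) (p q : R) (t : labelling n) :
  \sum_x sbm_pmf p q t x = 1.
Proof.
rewrite (sum_graph_prod R n (fun e b => edge_prob p q t e ^+ b *
   (1 - edge_prob p q t e) ^+ (1 - b)%N)).
by apply: big1 => e _ /=; rewrite !expr1 !expr0 mulr1 mul1r addrC subrK.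
Qed.

(** The sum over graphs of a product over edges factors edge by edge; on an edge
    where t and u agree the factor is the affinity of a law with itself, 1. *)
Lemma sbm_affinity (R : realType) (n : nat) (p q : R) (t u : labelling n) :
  0 <= p <= 1 -> 0 <= q <= 1 ->
  \sum_x Num.sqrt (sbm_pmf p q t x * sbm_pmf p q u x)
  = bernoulli_affinity p q ^+ #|disagreement_edges t u|.
Proof.
move=> hp hq.
pose F e (b : bool) := Num.sqrt (
  (edge_prob p q t e ^+ b * (1 - edge_prob p q t e) ^+ (1 - b)%N) *
  (edge_prob p q u e ^+ b * (1 - edge_prob p q u e) ^+ (1 - b)%N)).
transitivity (\sum_(x : graph n) \prod_e F e (x e)).
  apply: eq_bigr => x _; rewrite /sbm_pmf -big_split -sqrtr_prod //= => e.
  by rewrite mulr_ge0 ?bernoulli_pmf_ge0 ?edge_prob01.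
rewrite sum_graph_prod -prodr_const [RHS]big_mkcond; apply: eq_bigr => e _.
rewrite /F /= !expr1 !expr0 !mulr1 !mul1r -/(bernoulli_affinity _ _) inE.
rewrite /edge_prob.
by case: (t _) (t _) (u _) (u _) => [] [] [] [] /=;
  rewrite ?bernoulli_affinity_refl // bernoulli_affinityC.
Qed.

(** * Counting the edges on which two labellings disagree *)

Definition flip_set {n : nat} (t u : labelling n) : {set 'I_n} :=
  [set i | u i != t i].

Lemma hamming_card (n : nat) (t u : labelling n) :
  hamming u t = #|flip_set t u|.
Proof.
rewrite /hamming -sum1_card [RHS]big_mkcond; apply: eq_bigr => i _.
by rewrite inE; case: (t i) (u i) => [] [].
Qed.

(** Each pair of a flipped and an unflipped vertex spans an edge of
    disagreement. *)
Lemma card_flip_setC_le_disagreement (n : nat) (t u : labelling n) :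
  (#|flip_set t u| * #|~: flip_set t u| <= #|disagreement_edges t u|)%N.
Proof.
rewrite -cardsX.
(* Orient each edge of disagreement so that its flipped end comes first: every
   pair of a flipped and an unflipped vertex is then attained. *)
pose g (e : edge n) := if u (val e).1 != t (val e).1
  then ((val e).1, (val e).2) else ((val e).2, (val e).1).
apply: leq_trans (leq_imset_card g _); apply: subset_leq_card.
apply/fintype.subsetP=> -[i j]; rewrite !inE /= negbK => /andP[hi /eqP hj].
have [lij|lji|eij] := ltngtP (val i) (val j).
- apply/imsetP; exists (Sub (i, j) lij : edge n);
    rewrite ?inE /g !SubK /= hi //.
  by rewrite hj eqxx.
- apply/imsetP; exists (Sub (j, i) lji : edge n);
    rewrite ?inE /g !SubK /= hj eqxx //.
  by rewrite hi.
- by move: hi; rewrite (val_inj eij) hj eqxx.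
Qed.

(** Of the two factors of h (n - h), the smaller is the distance and the larger is
    at least n / 2. *)
Lemma kdist_le_disagreement (n : nat) (t u : labelling n) :
  (kdist u t * n <= 2 * #|disagreement_edges t u|)%N.
Proof.
have := card_flip_setC_le_disagreement n t u.
have := cardsC (flip_set t u); rewrite card_ord /kdist hamming_card.
move: #|flip_set t u| #|~: _| #|disagreement_edges t u| => a b N; nia.
Qed.

(** * Bayes' formula and the affinity *)

Lemma posterior_uniformE (R : realType) (n : nat) (p q : R)
    (A : {set labelling n}) (x : graph n) :
  A \subset Theta n ->
  posterior p q (@uniform_prior R n) A x =
  (\sum_(t in A) sbm_pmf p q t x) / (\sum_(t in Theta n) sbm_pmf p q t x).
Proof.
move=> /fintype.subsetP AT; rewrite /posterior.
have E (B : {set labelling n}) : {subset B <= Theta n} ->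
    \sum_(t in B) uniform_prior R t * sbm_pmf p q t x =
    (2 ^+ n.-1)^-1 * \sum_(t in B) sbm_pmf p q t x.
  move=> BT; rewrite mulr_sumr; apply: eq_bigr => t /BT.
  by rewrite /uniform_prior => ->.
by rewrite !E // -mulf_div divff ?mul1r // invr_eq0 expf_neq0 // pnatr_eq0.
Qed.

(** Both f t and f s are at most the normalising sum Z, so that
    f t * f s / Z <= sqrt (f t * f s): a product of two numbers below Z is at most
    Z times its square root.  If Z = 0 then f t = 0 and the left-hand side
    vanishes. *)
Lemma bayes_error_le_sqrt (R : realType) (T : finType) (f : T -> R)
    (A B : {set T}) (t : T) :
  (forall s, 0 <= f s) -> A \subset B -> t \in B ->
  f t * (1 - (\sum_(s in A) f s) / (\sum_(s in B) f s))
  <= \sum_(s in B :\: A) Num.sqrt (f t * f s).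
Proof.
move=> f0 AB tB; set Z := \sum_(s in B) f s.
have fleZ s : s \in B -> f s <= Z.
  by move=> sB; rewrite /Z (bigD1 s) //= lerDl sumr_ge0.
have Z0 : 0 <= Z by apply: sumr_ge0.
have [Z00|Zn0] := eqVneq Z 0.
  have -> : f t = 0 by apply/eqP; rewrite eq_le f0 -Z00 fleZ.
  by rewrite mul0r sumr_ge0 // => s _; rewrite sqrtr_ge0.
have -> : 1 - (\sum_(s in A) f s) / Z = (\sum_(s in B :\: A) f s) / Z.
  rewrite -[1](divff Zn0) -mulrBl {1}/Z (big_setID A) /=.
  by rewrite (finset.setIidPr AB) addrAC subrr add0r.
rewrite mulrA mulr_sumr mulr_suml; apply: ler_sum => s.
rewrite inE => /andP[_ sB].
rewrite ler_pdivrMr ?lt_def ?Zn0 //.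
rewrite -[X in X <= _]sqr_sqrtr ?mulr_ge0 // expr2 ler_wpM2l ?sqrtr_ge0 //.
rewrite -[leRHS]ger0_norm // -sqrtr_sqr ler_wsqrtr // expr2.
by rewrite ler_pM ?fleZ.
Qed.

(** The posterior mass outside A is a sum over labellings, and each of them is
    compared with t alone. *)
Lemma posterior_mass_ge (R : realType) (n : nat) (p q : R)
    (t : labelling n) (A : {set labelling n}) :
  0 <= p <= 1 -> 0 <= q <= 1 -> t \in Theta n -> A \subset Theta n ->
  1 - \sum_(u in Theta n :\: A)
        bernoulli_affinity p q ^+ #|disagreement_edges t u|
  <= sbm_expectation p q t (posterior p q (@uniform_prior R n) A).
Proof.
move=> hp hq tT AT; rewrite lerBlDr -lerBlDl -(sum_sbm_pmf _ _ p q t).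
rewrite /sbm_expectation -sumrB.
under [leRHS]eq_bigr do rewrite -sbm_affinity //.
rewrite exchange_big /=; apply: ler_sum => x _.
rewrite posterior_uniformE // -[X in X - _]mulr1 -mulrBr.
apply: (bayes_error_le_sqrt _ _ (fun s => sbm_pmf p q s x)) => // s.
exact: sbm_pmf_ge0.
Qed.

Lemma posterior_mass_le1 (R : realType) (n : nat) (p q : R)
    (t : labelling n) (A : {set labelling n}) :
  0 <= p <= 1 -> 0 <= q <= 1 -> A \subset Theta n ->
  sbm_expectation p q t (posterior p q (@uniform_prior R n) A) <= 1.
Proof.
move=> hp hq AT; rewrite -(sum_sbm_pmf _ _ p q t); apply: ler_sum => x _.
have f0 s := @sbm_pmf_ge0 R n p q s x hp hq.
rewrite posterior_uniformE // ler_piMr //.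
have [->|Zn0] := eqVneq (\sum_(s in Theta n) sbm_pmf p q s x) 0.
  by rewrite invr0 mulr0.
rewrite ler_pdivrMr ?lt_def ?Zn0 ?sumr_ge0 // mul1r [leRHS](big_setID A) /=.
by rewrite (finset.setIidPr AT) lerDl sumr_ge0.
Qed.

(** * Summation over distant labellings *)

(** Binomial theorem, with the subset of flipped vertices as summation index: a
    labelling is determined by the set on which it differs from t. *)
Lemma sum_expr_flip_set (R : realType) (n : nat) (t : labelling n) (a b : R) :
  \sum_(u : labelling n) a ^+ #|flip_set t u| * b ^+ #|~: flip_set t u|
  = (a + b) ^+ n.
Proof.
transitivity (\sum_(u : labelling n) \prod_i if u i != t i then a else b).
  apply: eq_bigr => u _; rewrite big_if /= !prodr_const.
  by congr (_ ^+ _ * _ ^+ _); apply: eq_card => i; rewrite !inE.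
rewrite -(bigA_distr_bigA (fun i x => if x != t i then a else b)) /=.
rewrite -[n in RHS]card_ord -[RHS]prodr_const; apply: eq_bigr => i _.
by rewrite big_bool; case: (t i); rewrite //= addrC.
Qed.

(** The distance being a minimum, a^k is at most a^h + a^(n - h). *)
Lemma sum_expr_kdist_le (R : realType) (n : nat) (t : labelling n) (a : R) :
  0 <= a -> \sum_(u : labelling n) a ^+ kdist u t <= 2 * expR (a * n%:R).
Proof.
move=> a0; apply: (@le_trans _ _ (\sum_(u : labelling n)
    (a ^+ #|flip_set t u| * 1 ^+ #|~: flip_set t u| +
     1 ^+ #|flip_set t u| * a ^+ #|~: flip_set t u|))).
  apply: ler_sum => u _; rewrite /kdist hamming_card !expr1n mulr1 mul1r.
  have -> : (n - #|flip_set t u| = #|~: flip_set t u|)%N.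
    by rewrite [RHS]cardsCs finset.setCK card_ord.
  by rewrite /minn; case: ifP => _; rewrite ?lerDl ?lerDr exprn_ge0.
rewrite big_split /= !sum_expr_flip_set [a + 1]addrC -mulr2n -[leLHS]mulr_natl.
rewrite ler_pM2l // expRM_natr.
by rewrite lerXn2r ?nnegrE ?addr_ge0 ?expR_ge0 ?expR_ge1Dx.
Qed.

Lemma affinity_le_kdist (R : realType) (n : nat) (p q : R) (t u : labelling n) :
  (0 < n)%N -> 0 <= p <= 1 -> 0 <= q <= 1 ->
  bernoulli_affinity p q ^+ #|disagreement_edges t u|
  <= expR (- (4^-1 * (n%:R * (Num.sqrt p - Num.sqrt q) ^+ 2) * (kdist u t)%:R)).
Proof.
move=> n0 hp hq; set s := (_ - _) ^+ 2; set N := #|_|.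
apply: (@le_trans _ _ (expR (- (s / 2)) ^+ N)).
  rewrite lerXn2r ?nnegrE ?expR_ge0 ?bernoulli_affinity_le_expR //.
  by rewrite addr_ge0 // sqrtr_ge0.
rewrite -expRM_natr ler_expR mulNr lerN2.
have s0 : 0 <= s by apply: sqr_ge0.
have : (kdist u t)%:R * n%:R <= 2 * N%:R :> R.
  by rewrite -!natrM ler_nat kdist_le_disagreement.
move: n%:R (kdist u t)%:R N%:R => x y z; nra.
Qed.

(** Exponential tilting: the factor a^k absorbs the number of labellings at
    distance k, and the remaining exp (- l k) is largest at the smallest
    admissible k. *)
Lemma affinity_sum_far_le (R : realType) (n : nat) (p q a : R)
    (t : labelling n) (A : {set labelling n}) :
  (0 < n)%N -> 0 <= p <= 1 -> 0 <= q <= 1 -> 0 < a ->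
  let l := ln a + 4^-1 * (n%:R * (Num.sqrt p - Num.sqrt q) ^+ 2) in
  0 <= l -> (forall u, u \in A -> a * n%:R <= (kdist u t)%:R) ->
  \sum_(u in A) bernoulli_affinity p q ^+ #|disagreement_edges t u|
  <= 2 * expR (- (a * n%:R * (l - 1))).
Proof.
move=> n0 hp hq a0 l l0 far.
apply: (@le_trans _ _
    (\sum_(u : labelling n) a ^+ kdist u t * expR (- (l * (a * n%:R))))).
  rewrite [leLHS]big_mkcond; apply: ler_sum => u _; case: ifP => [uA|_].
    apply: (le_trans (affinity_le_kdist _ _ _ _ _ _ n0 hp hq)).
    rewrite -{1}[a]lnK ?posrE // -expRM_natr -expRD ler_expR.
    have := ler_wpM2l l0 (far u uA); rewrite /l; lra.
  by rewrite mulr_ge0 ?expR_ge0 ?exprn_ge0 ?ltW.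
rewrite -mulr_suml.
apply: (le_trans (ler_wpM2r (expR_ge0 _) (sum_expr_kdist_le _ _ t a (ltW a0)))).
rewrite -[leLHS]mulrA ler_pM2l // -expRD ler_expR; lra.
Qed.

(** * Almost-exact recovery *)

Theorem proposition4p5 (R : realType) (c d p q a : nat -> R)
    (k : nat -> int) (theta : forall n : nat, labelling n)
    (hc0 : forall n : nat, (0 < n)%N -> 0 <= c n)
    (hd0 : forall n : nat, (0 < n)%N -> 0 <= d n)
    (hc : c =o_\oo (fun n : nat => ln (n%:R : R)))
    (hd : d =o_\oo (fun n : nat => ln (n%:R : R)))
    (hp : forall n : nat, (0 < n)%N -> p n = c n * n%:R^-1)
    (hq : forall n : nat, (0 < n)%N -> q n = d n * n%:R^-1)
    (hp01 : forall n : nat, (0 < n)%N -> 0 <= p n <= 1)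
    (hq01 : forall n : nat, (0 < n)%N -> 0 <= q n <= 1)
    (htheta : forall n : nat, (0 < n)%N -> theta n \in Theta n)
    (ha : forall n : nat, (0 < n)%N -> 0 < a n < 2^-1)
    (hlim : (fun n : nat =>
               a n * n%:R *
               (ln (a n) + 4^-1 * (Num.sqrt (c n) - Num.sqrt (d n)) ^+ 2 - 1))
            @ \oo --> +oo)
    (hk : forall n : nat, (0 < n)%N -> a n * n%:R <= (k n)%:~R) :
  (fun n : nat =>
     sbm_expectation (p n) (q n) (theta n)
       (posterior (p n) (q n) (@uniform_prior R n)
          (ball_n (theta n) ((k n)%:~R : R))))
  @ \oo --> (1 : R).
Proof.
set L := fun n : nat => a n * n%:R * _ in hlim.
have L0 : \forall n \near \oo, 0 < L n by move/cvgryPgt: hlim; apply.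
apply: (@squeeze_cvgr _ _ _ _ (fun n => 1 - 2 * expR (- L n)) (fun=> 1)).
- near=> n.
  have n0 : (0 < n)%N by near: n; exists 1%N.
  have [a0 _] := andP (ha n n0).
  have nR0 : 0 < n%:R :> R by rewrite ltr0n.
  have BT : ball_n (theta n) ((k n)%:~R : R) \subset Theta n.
    by apply/fintype.subsetP => u; rewrite inE => /andP[].
  (* The factor n in the exponent cancels the scaling p = c / n, q = d / n. *)
  have SE : n%:R * (Num.sqrt (p n) - Num.sqrt (q n)) ^+ 2 =
            (Num.sqrt (c n) - Num.sqrt (d n)) ^+ 2.
    have -> : c n = n%:R * p n by rewrite hp // mulrCA divff ?mulr1 ?gt_eqF.
    have -> : d n = n%:R * q n by rewrite hq // mulrCA divff ?mulr1 ?gt_eqF.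
    by rewrite !sqrtrM ?ler0n // -mulrBr exprMn sqr_sqrtr ?ler0n.
  apply/andP; split; last by rewrite posterior_mass_le1 ?hp01 ?hq01.
  apply: le_trans (posterior_mass_ge _ _ _ _ _ _
    (hp01 n n0) (hq01 n n0) (htheta n n0) BT).
  rewrite lerD2l lerN2 /L -SE;
  apply: affinity_sum_far_le => //; rewrite ?hp01 ?hq01 //.
  + have : 0 < L n by near: n; exact: L0.
    by rewrite /L -SE pmulr_rgt0 ?mulr_gt0 // subr_gt0 => /(lt_trans ltr01)/ltW.
  + move=> u; rewrite !inE => /andP[+ uT]; rewrite uT /= -ltNge => /ltW.
    by apply: le_trans; apply: hk.
- rewrite -[X in _ --> X](subr0 1) -[X in 1 - X](mulr0 2).
  apply: cvgB; first exact: cvg_cst.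
  apply: cvgM; first exact: cvg_cst.
  exact: (cvg_comp L (fun y => expR (- y)) hlim (@cvgr_expR R)).
- exact: cvg_cst.
Unshelve. all: by end_near.
Qed.
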